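(* Let $G$ be a finite group, let $I$ and $\Lambda$ be finite (non-empty) index sets, and let $P=(p_{\lambda i})$ be a regular $\Lambda\times I$ matrix with entries in $G^0$ that contains at least one zero entry. Suppose that $\mathcal{G}(\mathcal{M}_0[G;I,\Lambda;P])$ is not connected. Let $i\in I$ and $\lambda\in\Lambda$ be such that row $\lambda$ of $P$ has no zero entries or column $i$ of $P$ has no zero entries. Let $\mathcal{C}$ be the connected component of $\mathcal{G}(\mathcal{M}_0[G;I,\Lambda;P])$ determined by $(\lambda,i)$, i.e. the connected component with vertex set $\{i\}\times G\times\{\lambda\}$. Then $$\mathrm{diam}(\mathcal{C})=\begin{cases}0&\text{if }G\text{ is trivial},\\1&\text{if }G\text{ is abelian and not trivial},\\2&\text{if }G\text{ is not abelian}.\end{cases}$$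
   Context: $G^0=G\cup\{0\}$ is $G$ with a zero adjoined. A matrix over $G^0$ is regular if every row and every column contains a non-zero entry. The $0$-Rees matrix semigroup $\mathcal{M}_0[G;I,\Lambda;P]$ is the set $(I\times G\times\Lambda)\cup\{0\}$ with $(i,x,\lambda)(j,y,\mu)=(i,xp_{\lambda j}y,\mu)$ if $p_{\lambda j}\neq 0$, $(i,x,\lambda)(j,y,\mu)=0$ if $p_{\lambda j}=0$, and all products involving $0$ equal to $0$. The commuting graph $\mathcal{G}(S)$ of a finite non-commutative semigroup $S$ is the simple graph with vertex set $S\setminus Z(S)$ ($Z(S)$ the center), where distinct $x,y$ are adjacent iff $xy=yx$. (When $P$ is regular and has a zero entry, $\mathcal{M}_0[G;I,\Lambda;P]$ is non-commutative with center $\{0\}$.) $\mathrm{diam}$ is the maximum distance between two vertices. If row $\lambda$ or column $i$ of $P$ has no zero entries, the subgraph of $\mathcal{G}(\mathcal{M}_0[G;I,\Lambda;P])$ induced by $\{i\}\times G\times\{\lambda\}$ is a connected component. *)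

(* Defs.v *)
From HB Require Import structures.
From mathcomp Require Import all_boot.

(* Declared before loading [fingroup]: Hierarchy-Builder rejects it afterwards,
   the join with [FinStarMonoid] being missing there. *)
#[short(type="finSemigroupType")]
HB.structure Definition FinSemigroup := {S of Semigroup S & Finite S}.

From mathcomp Require Import all_fingroup.

Set Implicit Arguments.
Unset Strict Implicit.
Unset Printing Implicit Defensive.

Local Open Scope group_scope.

(** * Finite simple graphs *)

Record sgraph := SGraph {
  vertex :> finType;
  adj : rel vertex;
  adj_sym : symmetric adj;
  adj_irrefl : irreflexive adj }.

Arguments adj {s} x y.

Section GraphNotions.

Variable H : sgraph.
Implicit Types (x y : H) (A C : {set H}).

Definition connected : bool := [forall x : H, forall y : H, connect adj x y].

Definition is_component C : bool :=
  [exists x : H, C == [set y | connect adj x y]].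

Definition walk x y (n : nat) : bool :=
  [exists p : n.-tuple H, path adj x p && (last x p == y)].

Lemma connect_walk x y : connect adj x y -> exists n, walk x y n.
Proof.
case/connectP=> p xp ->; exists (size p).
by apply/existsP; exists (in_tuple p); rewrite xp eqxx.
Qed.

(* [None] stands for an infinite distance. *)
Definition dist x y : option nat :=
  if @idP (connect adj x y) is ReflectT xy then Some (ex_minn (connect_walk xy))
  else None.

(* [None] stands for an infinite diameter, i.e. some distance is infinite. *)
Definition diam : option nat :=
  if [forall x : H, forall y : H, dist x y != None]
  then Some (\max_(x : H) \max_(y : H) odflt 0%N (dist x y))
  else None.

Section Induced.
Variable A : {set H}.
Definition induced_adj : rel {x : H | x \in A} := fun u v => adj (val u) (val v).
Lemma induced_adj_sym : symmetric induced_adj.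
Proof. by move=> x y; apply: adj_sym. Qed.
Lemma induced_adj_irrefl : irreflexive induced_adj.
Proof. by move=> x; apply: adj_irrefl. Qed.
Definition induced : sgraph := SGraph induced_adj_sym induced_adj_irrefl.
End Induced.

End GraphNotions.

(** * Commuting graphs of finite semigroups *)

Section CommutingGraph.

Variable S : finSemigroupType.

Definition scenter : {set S} := [set x | [forall y : S, x * y == y * x]].

Definition commuting_adj : rel {x : S | x \notin scenter} :=
  fun x y => (x != y) && (val x * val y == val y * val x).

Lemma commuting_adj_sym : symmetric commuting_adj.
Proof. by move=> x y; rewrite /commuting_adj eq_sym [RHS]andbC andbC eq_sym. Qed.

Lemma commuting_adj_irrefl : irreflexive commuting_adj.
Proof. by move=> x; rewrite /commuting_adj eqxx. Qed.

Definition commuting_graph : sgraph :=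
  SGraph commuting_adj_sym commuting_adj_irrefl.

End CommutingGraph.

(** * 0-Rees matrix semigroups *)

(* [option G] is G^0, with [None] as the adjoined zero. *)
Definition regular (G : finGroupType) (I L : finType) (P : L -> I -> option G) :=
  (forall l, exists i, P l i <> None) /\ (forall i, exists l, P l i <> None).

(* [None] is the zero of the semigroup. The matrix [P] is a phantom parameter,
   on which the semigroup instance below depends. *)
Definition rees0 (G : finGroupType) (I L : finType) (P : L -> I -> option G)
  : Type := option (I * G * L).

Section Rees.

Variables (G : finGroupType) (I L : finType) (P : L -> I -> option G).

Local Notation rees0 := (rees0 P).

HB.instance Definition _ := Finite.copy rees0 (option (I * G * L)).

Definition rees0_mul (a b : rees0) : rees0 :=
  if a is Some (i, x, l) then
    if b is Some (j, y, m) then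
      if P l j is Some p then Some (i, x * p * y, m) else None
    else None
  else None.

Lemma rees0_mulA : associative rees0_mul.
Proof.
move=> [[[i x] l]|] [[[j y] m]|] [[[k z] n]|] //=;
  case Pj: (P l j) => [p|] //=; case Pk: (P m k) => [q|] //=; rewrite ?Pj ?Pk //.
by rewrite !mulgA.
Qed.

HB.instance Definition _ := isSemigroup.Build rees0 rees0_mulA.

(* The vertices lying in {i} x G x {l}; see [rees0_component_is_component]. *)
Definition rees0_component (i : I) (l : L) : {set commuting_graph rees0} :=
  [set v | [exists x : G, val v == Some (i, x, l) :> rees0]].

Lemma rees0_center :
  regular P -> (exists l i, P l i = None) ->
  scenter rees0 = [set None : rees0].
Proof.
move=> regP zeroP; apply/setP=> a; rewrite !inE; apply/forallP/eqP => [ca|->]; last first.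
  by move=> [[[j y] m]|].
case: a ca => [[[i x] l]|//] ca.
have {}ca j m y : rees0_mul (Some (i, x, l)) (Some (j, y, m)) =
                  rees0_mul (Some (j, y, m)) (Some (i, x, l)).
  exact: (eqP (ca (Some (j, y, m) : rees0))).
have [rowP colP] := regP; have [l0 [i0 P0]] := zeroP.
have [j Pj] := rowP l; have [m Pm] := colP i.
have eqL k : l = k.
  move: (ca j k 1) => /=; case: (P l j) Pj => // p _; case: (P k i) => // q.
  by case=> _ _ ->.
have eqI k : i = k.
  move: (ca k m 1) => /=; case: (P m i) Pm => // p _; case: (P l k) => // q.
  by case=> ->.
by move: Pj; rewrite -(eqI j) (eqI i0) (eqL l0) P0.
Qed.

Lemma rees0_component_is_component i l :
  regular P -> (exists l i, P l i = None) ->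
  (forall j, P l j <> None) \/ (forall m, P m i <> None) ->
  is_component (rees0_component i l).
Proof.
move=> regP zeroP Pil; have center0 := rees0_center regP zeroP.
have [p Pp] : exists p, P l i = Some p.
  by case: Pil => [/(_ i)|/(_ l)]; case: (P l i) => // p _; exists p.
have nzP x : (Some (i, x, l) : rees0) \notin scenter rees0.
  by rewrite center0 inE.
pose v x : commuting_graph rees0 := Sub (Some (i, x, l) : rees0) (nzP x).
apply/existsP; exists (v p^-1); apply/eqP/setP=> w; rewrite !inE.
apply/idP/idP => [/existsP[x /eqP wE]|].
  have -> : w = v x by apply: val_inj.
  have [->|ne] := eqVneq (v p^-1) (v x); first exact: connect0.
  apply: connect1; rewrite /= /commuting_adj ne /=; apply/eqP.
  by rewrite /mul /= Pp mulVg mul1g -mulgA mulgV mulg1.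
case/connectP=> q; elim/last_ind: q w => [|q u IH] w /=.
  by move=> _ ->; apply/existsP; exists p^-1.
rewrite rcons_path last_rcons => /andP[/IH{}IH uw] ->.
case/existsP: (IH _ erefl) uw => x /eqP; set t := last _ _ => tE.
rewrite /commuting_adj /= => /andP[_]; rewrite tE.
have: (sval u : rees0) \notin [set None : rees0].
  by rewrite -center0; apply: (valP u).
rewrite inE; case: (sval u) => [[[j y] m]|//] _ /eqP.
rewrite /mul /= => E.
suff [-> ->] : j = i /\ m = l by apply/existsP; exists y.
case: Pil E => [/(_ j)|/(_ m)].
  by case: (P l j) => // a _; case: (P m i) => // b [-> _ ->].
by case: (P m i) => // a _; case: (P l j) => // b [-> _ ->].
Qed.

End Rees.

(* Main.v *)
Require Import Defs.
From mathcomp Require Import all_boot all_fingroup.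

(** Writing p for the non-zero entry P l i, the map g |-> (i, g p^-1, l) is a
    bijection from G onto the component, under which two elements of the
    component commute exactly when the corresponding elements of G do. The
    component is thus the graph on all of G whose edges are the commuting pairs;
    1 is adjacent to every other vertex, so the diameter is at most 2, and it
    reaches 2 exactly when some pair does not commute. *)

Set Implicit Arguments.
Unset Strict Implicit.
Unset Printing Implicit Defensive.

Local Open Scope group_scope.

Section Diameter.

Variable H : sgraph.
Implicit Types x y : H.

Lemma walkP x y n :
  reflect (exists p, [/\ size p = n, path adj x p & last x p = y]) (walk x y n).
Proof.
apply: (iffP existsP) => [[p /andP[xp /eqP yE]]|[p [sp xp yE]]].
  by exists p; rewrite size_tuple.
by move/eqP: sp => sp; exists (Tuple sp); rewrite /= xp yE eqxx.
Qed.

(** [dist] branches on a proof of connectedness; any walk supplies one, and the minimality in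
    [ex_minn] then gives the bound by [n]. *)
Lemma dist_walk x y n : walk x y n ->
  exists m, [/\ dist x y = Some m, walk x y m & m <= n].
Proof.
move=> xy_n; rewrite /dist; case: {-}_ / idP => [xy|[]]; last first.
  by case/walkP: xy_n => p [_ xp <-]; apply/connectP; exists p.
by case: ex_minnP => m xy_m /(_ _ xy_n); exists m.
Qed.

(** As [dist] is a minimal length, one short walk per pair bounds the maximum from above and also
    rules out the value [None]. A single pair joined by no shorter walk bounds it from below. *)
Lemma diam_eq n :
    (forall x y, exists2 k, k <= n & walk x y k) ->
    (exists x y, forall k, walk x y k -> n <= k) ->
  diam H = Some n.
Proof.
move=> le_n [x0 [y0 ge_n]].
have distP x y : exists m, [/\ dist x y = Some m, walk x y m & m <= n].
  have [k kn /dist_walk[m [-> wm mk]]] := le_n x y.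
  by exists m; rewrite (leq_trans mk kn).
have fin : [forall x : H, forall y : H, dist x y != None].
  by apply/forallP=> x; apply/forallP=> y; have [m [->]] := distP x y.
rewrite /diam fin; congr Some; apply/eqP; rewrite eqn_leq; apply/andP; split.
  apply/bigmax_leqP=> x _; apply/bigmax_leqP=> y _.
  by have [m [->]] := distP x y.
apply: leq_trans (leq_bigmax x0); apply: leq_trans (leq_bigmax y0).
by have [m [-> /ge_n]] := distP x0 y0.
Qed.

End Diameter.

(** Keeping [H] abstract, with [v] as a graph isomorphism, reduces the computation to [G] and hides
    the nested subtypes of the induced graph. *)
Lemma diam_commuting (G : finGroupType) (H : sgraph) (v : G -> H) :
    injective v -> (forall u, exists g, u = v g) ->
    (forall g h, adj (v g) (v h) = (g != h) && (g * h == h * g)) ->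
  diam H = Some (if #|G| == 1%N then 0%N
                 else if abelian [set: G] then 1%N
                 else 2%N).
Proof.
move=> v_inj v_surj v_adj.
have walk0 g : walk (v g) (v g) 0 by apply/walkP; exists [::].
have walk1 g h : g != h -> g * h = h * g -> walk (v g) (v h) 1.
  by move=> ne com; apply/walkP; exists [:: v h]; rewrite /= v_adj ne com eqxx.
case: ifP => [/fintype1P[e eqe]|G_neq1].
  apply: diam_eq => [x y|]; last by exists (v e), (v e).
  have [g ->] := v_surj x; have [h ->] := v_surj y.
  by exists 0 => //; rewrite (eqe g) (eqe h).
have walk_gt0 g h k : g != h -> walk (v g) (v h) k -> 0 < k.
  by case: k => // /eqP ne /walkP[p [/size0nil -> _ /v_inj]].
case: ifP => [/centsP abG|/negP nabG].
  apply: diam_eq => [x y|].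
    have [g ->] := v_surj x; have [h ->] := v_surj y.
    have [->|ne] := eqVneq g h; first by exists 0.
    by exists 1%N => //; apply: walk1 => //; apply: abG; rewrite inE.
  have [g ne] : exists g : G, g != 1.
    apply/existsP; rewrite -negb_forall; apply: contraFN G_neq1 => /forallP e1.
    by apply/fintype1P; exists 1 => g; apply/eqP.
  by exists (v g), (v 1) => k; apply: walk_gt0.
apply: diam_eq => [x y|].
  have [g ->] := v_surj x; have [h ->] := v_surj y.
  have [->|ne] := eqVneq g h; first by exists 0.
  (* The walk of length 2 goes through [v 1]. Since adjacency is irreflexive, the cases where an
     endpoint is itself [v 1] are treated apart. *)
  have [->|ne_g] := eqVneq g 1.
    have [->|ne_h] := eqVneq h 1; first by exists 0.
    by exists 1%N => //; apply: walk1; rewrite 1?eq_sym // mul1g mulg1.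
  have [->|ne_h] := eqVneq h 1.
    by exists 1%N => //; apply: walk1; rewrite // mul1g mulg1.
  exists 2 => //; apply/walkP; exists [:: v 1; v h].
  by rewrite /= !v_adj ne_g (eq_sym 1) ne_h !mul1g !mulg1 !eqxx.
have /existsP[g /existsP[h gh]] : [exists g : G, exists h : G, g * h != h * g].
  apply: contra_notT nabG => /existsPn com; apply/centsP=> g _ h _; apply/eqP.
  by have /existsPn/(_ h) := com g; rewrite negbK.
have ne : g != h by apply: contraNneq gh => ->.
(* Length 0 would force [g = h], and length 1 would be an edge, making [g] and [h] commute. *)
exists (v g), (v h) => -[|[|k]] // /[dup] /(walk_gt0 _ _ _ ne) // _.
case/walkP=> [[|u [|u1 q]] []] //= _ /[swap] ->.
by rewrite v_adj (negPf gh) andbF.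
Qed.

Theorem proposition4p24 (G : finGroupType) (I L : finType)
    (P : L -> I -> option G)
    (I_nonempty : (0 < #|I|)%N) (L_nonempty : (0 < #|L|)%N)
    (P_regular : regular P)
    (P_zero : exists l i, P l i = None)
    (not_connected : ~~ connected (commuting_graph (rees0 P)))
    (i : I) (l : L)
    (no_zero : (forall j, P l j <> None) \/ (forall m, P m i <> None)) :
  diam (induced (rees0_component P i l)) =
    Some (if #|G| == 1%N then 0%N
          else if abelian [set: G] then 1%N
          else 2%N).
Proof.
(* The entry [P l i] lies both in row [l] and in column [i], so either alternative makes it
   non-zero. *)
have [p Pp] : exists p, P l i = Some p.
  by case: no_zero => [/(_ i)|/(_ l)]; case: (P l i) => // p _; exists p.
have ncentral x : (Some (i, x, l) : rees0 P) \notin scenter (rees0 P).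
  by rewrite rees0_center // inE.
pose w x : commuting_graph (rees0 P) := Sub (Some (i, x, l) : rees0 P) (ncentral x).
have in_comp x : w x \in rees0_component P i l.
  by rewrite inE; apply/existsP; exists x; apply/eqP.
pose v g : induced (rees0_component P i l) :=
  Sub (w (g * p^-1)) (in_comp (g * p^-1)).
have v_inj : injective v.
  by move=> g h /(congr1 val) /(congr1 val) [] /mulIg.
apply: (@diam_commuting _ _ v) => // [u|g h].
  have := valP u; rewrite inE => /existsP[x /eqP ux]; exists (x * p).
  by apply: val_inj; apply: val_inj; rewrite /= mulgK.
rewrite /adj /= /induced_adj /= /commuting_adj; congr (_ && _).
  by congr (~~ _); apply/eqP/eqP => [wE|->//]; apply: v_inj; apply: val_inj.
(* The sandwich entry [p] cancels the inner [p^-1]: the product of the images of [g] and [h] has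
   middle component [g * h * p^-1], and the common right factor [p^-1] cancels. *)
rewrite /= /mul /= Pp !mulgKV !mulgA.
by apply/eqP/eqP => [[/mulIg]|gh] //; congr (Some (_, _ * _, _)).
Qed.
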